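(* Let $L$ be a commutative field extending $\mathbb{R}$ and let $\mathbb{F}$ be a subfield of $L$. If $x,y \in \mathbb{R}^2$ and $|x-y|^2$ is a rational number, then there exists a finite set $S_{xy}$ with $\{x,y\} \subseteq S_{xy} \subseteq \mathbb{R}^2$ such that any map $f: S_{xy} \to \mathbb{F}^2$ that preserves unit distance preserves also the distance between $x$ and $y$, i.e. satisfies $\varphi_2(f(x),f(y)) = |x-y|^2$. In other words, $\{d>0 : d^2 \in \mathbb{Q}\} \subseteq D_2(\mathbb{F})$.
   Context: $|\cdot|$ is the Euclidean norm on $\mathbb{R}^2$. The map $\varphi_2: \mathbb{F}^2 \times \mathbb{F}^2 \to \mathbb{F}$ is $\varphi_2((x_1,x_2),(y_1,y_2)) = (x_1-y_1)^2+(x_2-y_2)^2$. Real numbers are regarded as elements of $L \supseteq \mathbb{R}$, and equalities between values of $\varphi_2$ and real numbers are equalities in $L$ (the field $\mathbb{F}$ need not contain $\mathbb{R}$). For $S \subseteq \mathbb{R}^2$, a map $f: S \to \mathbb{F}^2$ preserves unit distance if $|u-v|=1$ implies $\varphi_2(f(u),f(v))=1$ for all $u,v \in S$; it preserves the distance between $x,y\in S$ if $\varphi_2(f(x),f(y)) = |x-y|^2$. $D_2(\mathbb{F})$ denotes the set of all real $d>0$ such that: whenever $x,y \in \mathbb{R}^2$ and $|x-y|=d$, there exists a finite set $S_{xy}$ with $\{x,y\} \subseteq S_{xy} \subseteq \mathbb{R}^2$ such that any map $f:S_{xy}\to\mathbb{F}^2$ that preserves unit distance preserves also the distance between $x$ and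 $y$. *)

(* Defs.v *)
From HB Require Import structures.
From mathcomp Require Import all_boot all_order all_algebra.
From mathcomp Require Import all_classical all_reals.

Set Implicit Arguments.
Unset Strict Implicit.
Unset Printing Implicit Defensive.

Import Order.TTheory GRing.Theory Num.Theory.

Local Open Scope classical_set_scope.
Local Open Scope ring_scope.

(* The norm that MathComp-Analysis puts on 'rV[R]_2 is the sup norm, so the
   Euclidean norm is defined separately. *)
Definition enorm (R : realType) (u : 'rV[R]_2) : R :=
  Num.sqrt (u 0 0 ^+ 2 + u 0 1 ^+ 2).

Definition phi2 (K : fieldType) (x y : 'rV[K]_2) : K :=
  (x 0 0 - y 0 0) ^+ 2 + (x 0 1 - y 0 1) ^+ 2.

(* The inclusion of the reals in L is the (automatically injective) ring
   morphism iota, and the subfield FF of L is a predicate on L, so that FF^2 is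
   the set of row vectors of L^2 with entries in FF.  A map f : S -> FF^2 is
   represented by a function on the whole plane that sends S to FF^2; its values
   outside S are never used. *)
Section UnitDistance.
Variables (R : realType) (L : fieldType) (iota : {rmorphism R -> L}).

Definition plane_over (FF : divringClosed L) : set 'rV[L]_2 :=
  [set v | v \is a mxOver FF].

Definition preserves_unit_distance (S : set 'rV[R]_2)
    (f : 'rV[R]_2 -> 'rV[L]_2) : Prop :=
  forall u v, S u -> S v -> enorm (u - v) = 1 -> phi2 (f u) (f v) = 1.

Definition preserves_distance (f : 'rV[R]_2 -> 'rV[L]_2) (x y : 'rV[R]_2) :
    Prop :=
  phi2 (f x) (f y) = iota (enorm (x - y) ^+ 2).

Definition has_forcing_set (FF : divringClosed L) (x y : 'rV[R]_2) : Prop :=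
  exists S : set 'rV[R]_2,
    [/\ finite_set S,
        [set x; y] `<=` S &
        forall f : 'rV[R]_2 -> 'rV[L]_2,
          set_fun S (plane_over FF) f ->
          preserves_unit_distance S f -> preserves_distance f x y].

Definition D2 (FF : divringClosed L) : set R :=
  [set d | 0 < d /\
    forall x y : 'rV[R]_2, enorm (x - y) = d -> has_forcing_set FF x y].

End UnitDistance.

(* Main.v *)
Require Import Defs.
From mathcomp Require Import all_boot all_order all_algebra.
From mathcomp Require Import all_classical all_reals.
From mathcomp Require Import ring lra.

(** Call a real number t rigid when every pair of points at squared distance t
    has a finite set forcing that squared distance ([rigid]).  The number 1 is
    rigid by definition, and the theorem says that every rational t >= 0 is.

    Besides characteristic zero, the only fact about the target plane that is
    needed is that, although its quadratic form may have nonzero isotropic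
    vectors, two points p and q at nonzero squared distance still span an
    orthogonal frame (the vector q - p and its quarter turn).  Hence at
    most two points have a given common squared distance to p and q, and two
    such points x, y satisfy x = y or x + y = p + q
    ([equidistant_dichotomy]).

    So if a and b are rigid and p, x, q, y is a rhombus with sides of squared
    length b and diagonal pq of squared length a, then the image of the rhombus
    is a parallelogram unless x and y are identified.  Identification is
    excluded as in the Moser spindle: take a second such rhombus with the same
    vertex x and opposite vertex z, where the squared distance e of y and z is
    rigid, positive and smaller than that of x and y.  Then f x = f y would put
    f z at squared distance e from f x, whereas only 0 and 4 b - a are possible.
    Therefore f maps the rhombus to a parallelogram ([rhombus_closes]), and by
    the parallelogram law 4 b - a is rigid ([rigid_diagonal]).

    With a = b = e = t this applies to pairs of equilateral triangles; gluing
    three of them shows that f preserves the midpoint of two consecutive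
    segments of squared length t ([forced_midpoint]), hence arithmetic
    progressions with such steps ([forced_progression]).  Consequently rigid
    numbers can be multiplied by n^2 ([rigid_mulX2]) and, by comparing a long
    isosceles triangle with its homothetic image, divided by n^2
    ([rigid_divX2]).  So all squares of positive rationals are rigid; in
    particular there are arbitrarily small e for the spindle.  Finally any
    rational t is a difference of rational squares,
       t = 4 ((t + 1) / 4)^2 - ((t - 1) / 2)^2,
    which is the form 4 b - a required by [rigid_diagonal]. *)

Set Implicit Arguments.
Unset Strict Implicit.
Unset Printing Implicit Defensive.

Import Order.TTheory GRing.Theory Num.Theory.

Local Open Scope classical_set_scope.
Local Open Scope ring_scope.

(** * The quadratic form on the plane over an arbitrary field *)

Section QuadraticPlane.
Variable K : fieldType.
Implicit Types x y z p q u v : 'rV[K]_2.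

Lemma rV2P x y : x = y <-> x 0 0 = y 0 0 /\ x 0 1 = y 0 1.
Proof.
split=> [-> //|[e0 e1]]; apply/rowP; case=> [[|[|//]] lt_j2].
  by rewrite (_ : Ordinal _ = 0) //; apply: val_inj.
by rewrite (_ : Ordinal _ = 1) //; apply: val_inj.
Qed.

Lemma phi2C x y : phi2 x y = phi2 y x.
Proof. by rewrite /phi2; ring. Qed.

Lemma phi2xx x : phi2 x x = 0.
Proof. by rewrite /phi2; ring. Qed.

Lemma phi2_homothety x u v n :
  phi2 (x + u *+ n) (x + v *+ n) = n%:R ^+ 2 * phi2 (x + u) (x + v).
Proof. by rewrite /phi2 -!scaler_nat !mxE; ring. Qed.

Lemma phi2_parallelogram x y p q : x + y = p + q ->
  phi2 x y + phi2 p q = 2 * (phi2 x p + phi2 x q).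
Proof.
move=> /rV2P; rewrite /phi2 !mxE => -[e0 e1].
have -> : y 0 0 = p 0 0 + q 0 0 - x 0 0 by rewrite -e0; ring.
have -> : y 0 1 = p 0 1 + q 0 1 - x 0 1 by rewrite -e1; ring.
ring.
Qed.

(** The vectors w and its quarter turn form an orthogonal basis as soon as w is
    not isotropic; both coordinates of v in that basis vanish here. *)
Lemma orthogonal_parallel_eq0 (v0 v1 w0 w1 : K) :
  w0 ^+ 2 + w1 ^+ 2 != 0 ->
  v0 * w0 + v1 * w1 = 0 -> v0 * w1 - v1 * w0 = 0 -> v0 = 0 /\ v1 = 0.
Proof.
move=> w_neq0 dot0 cross0; split; apply: (mulfI w_neq0); rewrite mulr0.
  transitivity (w0 * (v0 * w0 + v1 * w1) + w1 * (v0 * w1 - v1 * w0)).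
    by ring.
  by rewrite dot0 cross0; ring.
transitivity (w1 * (v0 * w0 + v1 * w1) - w0 * (v0 * w1 - v1 * w0)).
  by ring.
by rewrite dot0 cross0; ring.
Qed.

(** With w = q - p, d = x - y and s = x + y - p - q, subtracting the four
    distance equations shows that d and s are both orthogonal to w, hence both
    multiples of its quarter turn, and orthogonal to each other.  As w is not
    isotropic, neither is its quarter turn, so d or s is zero. *)
Lemma equidistant_dichotomy (b : K) x y p q :
  2 != 0 :> K -> phi2 p q != 0 ->
  phi2 x p = b -> phi2 x q = b -> phi2 y p = b -> phi2 y q = b ->
  x = y \/ x + y = p + q.
Proof.
move=> two_neq0 pq_neq0 xp xq yp yq.
pose w0 := q 0 0 - p 0 0; pose w1 := q 0 1 - p 0 1.
pose d0 := x 0 0 - y 0 0; pose d1 := x 0 1 - y 0 1.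
pose s0 := x 0 0 + y 0 0 - (p 0 0 + q 0 0).
pose s1 := x 0 1 + y 0 1 - (p 0 1 + q 0 1).
have w_neq0 : w0 ^+ 2 + w1 ^+ 2 != 0.
  by move: pq_neq0; rewrite phi2C.
have dw : d0 * w0 + d1 * w1 = 0.
  apply: (mulfI two_neq0); rewrite mulr0.
  transitivity (phi2 x p - phi2 x q - (phi2 y p - phi2 y q)).
    by rewrite /phi2 /d0 /d1 /w0 /w1; ring.
  by rewrite xp xq yp yq; ring.
have sw : s0 * w0 + s1 * w1 = 0.
  apply: (mulfI two_neq0); rewrite mulr0.
  transitivity (phi2 x p - phi2 x q + (phi2 y p - phi2 y q)).
    by rewrite /phi2 /s0 /s1 /w0 /w1; ring.
  by rewrite xp xq yp yq; ring.
have ds : d0 * s0 + d1 * s1 = 0.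
  apply: (mulfI two_neq0); rewrite mulr0.
  transitivity (phi2 x p + phi2 x q - (phi2 y p + phi2 y q)).
    by rewrite /phi2 /s0 /s1 /d0 /d1; ring.
  by rewrite xp xq yp yq; ring.
(* Lagrange's identity turns the three dot products into a product of the two
   cross products with w. *)
have : (d0 * w1 - d1 * w0) * (s0 * w1 - s1 * w0) = 0.
  transitivity ((d0 * s0 + d1 * s1) * (w0 ^+ 2 + w1 ^+ 2) -
                (d0 * w0 + d1 * w1) * (s0 * w0 + s1 * w1)); first by ring.
  by rewrite dw sw ds; ring.
move=> /eqP; rewrite mulf_eq0 => /orP[] /eqP cross0; [left|right].
  have [/eqP + /eqP] := orthogonal_parallel_eq0 w_neq0 dw cross0.
  by rewrite !subr_eq0 => /eqP e0 /eqP e1; apply/rV2P.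
have [/eqP + /eqP] := orthogonal_parallel_eq0 w_neq0 sw cross0.
by rewrite !subr_eq0 => /eqP e0 /eqP e1; apply/rV2P; rewrite !mxE.
Qed.

End QuadraticPlane.

(** * Triangles and rhombi in the Euclidean plane *)

Section EuclideanPlane.
Variable R : realType.
Implicit Types x y z p q : 'rV[R]_2.

Lemma phi2_eq0 x y : phi2 x y = 0 -> x = y.
Proof.
move=> /eqP; rewrite paddr_eq0 ?sqr_ge0 // !sqrf_eq0 !subr_eq0.
by move=> /andP[/eqP e0 /eqP e1]; apply/rV2P.
Qed.

Lemma sqr_enormB x y : enorm (x - y) ^+ 2 = phi2 x y.
Proof. by rewrite sqr_sqrtr !mxE // addr_ge0 ?sqr_ge0. Qed.

Lemma enormB_eq1 x y : (enorm (x - y) = 1) <-> (phi2 x y = 1).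
Proof.
rewrite -sqr_enormB; split=> [->|/eqP]; first by rewrite expr1n.
by rewrite sqrp_eq1 ?sqrtr_ge0 // => /eqP.
Qed.

(** The parameters are squared side lengths, and the hypothesis is the triangle
    inequality in polynomial form: by Heron's formula the difference of its two
    sides is 16 times the squared area. *)
Lemma exists_triangle (a b : R) x y :
  let c := phi2 x y in
  0 < c -> a ^+ 2 + b ^+ 2 + c ^+ 2 <= 2 * (a * b + b * c + c * a) ->
  exists z, phi2 z x = a /\ phi2 z y = b.
Proof.
move=> c c_gt0 heron.
pose h := 2 * (a * b + b * c + c * a) - (a ^+ 2 + b ^+ 2 + c ^+ 2).
have h_ge0 : 0 <= h by rewrite subr_ge0.
(* Coordinates of z - x in the frame made of y - x and its quarter turn: the
   foot of the altitude, and the altitude relative to the base. *)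
pose al := (a + c - b) / (2 * c); pose be := Num.sqrt h / (2 * c).
have c_neq0 : c != 0 by rewrite gt_eqF.
have be2 : be ^+ 2 = h / (4 * c ^+ 2).
  by rewrite expr_div_n sqr_sqrtr //; field.
pose w0 := y 0 0 - x 0 0; pose w1 := y 0 1 - x 0 1.
have cE : w0 ^+ 2 + w1 ^+ 2 = c by rewrite /c phi2C.
pose z : 'rV[R]_2 := \row_j (if j == 0 then x 0 0 + al * w0 - be * w1
                             else x 0 1 + al * w1 + be * w0).
exists z; rewrite /phi2 !mxE /=; split.
  transitivity ((al ^+ 2 + be ^+ 2) * (w0 ^+ 2 + w1 ^+ 2)); first by ring.
  by rewrite cE be2 /al /h; field.
transitivity (((al - 1) ^+ 2 + be ^+ 2) * (w0 ^+ 2 + w1 ^+ 2)).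
  by rewrite /w0 /w1; ring.
by rewrite cE be2 /al /h; field.
Qed.

Lemma exists_rhombus (a b : R) x z :
  0 <= a -> 0 < phi2 x z -> phi2 x z = 4 * b - a ->
  exists p q, [/\ phi2 p q = a, phi2 x p = b, phi2 x q = b & x + z = p + q].
Proof.
move=> a_ge0 c_gt0 cE.
have [|p [px pz]] := @exists_triangle b b x z c_gt0.
  have : 0 <= (4 * b - a) * a by rewrite mulr_ge0 // -cE ltW.
  by rewrite cE; lra.
have e : x + z = p + (x + z - p) by rewrite [RHS]addrC subrK.
have xq : phi2 x (x + z - p) = b.
  by rewrite -pz /phi2 !mxE; ring.
exists p, (x + z - p); split=> //; last by rewrite phi2C.
by have := phi2_parallelogram e; rewrite xq (phi2C x p) px cE; lra.
Qed.

End EuclideanPlane.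

(** * Properties forced by finitely many unit distances *)

Section Forcing.
Variables (R : realType) (L : fieldType) (iota : {rmorphism R -> L}).
Implicit Types (x y z p q u v : 'rV[R]_2) (f : 'rV[R]_2 -> 'rV[L]_2).
Implicit Types (P Q : ('rV[R]_2 -> 'rV[L]_2) -> Prop) (t s a b c e : R).

(** The forced properties form a filter on maps, which hides the bookkeeping of
    finite sets: a consequence of finitely many forced properties is forced. *)
Definition forced Q := exists2 S : set 'rV[R]_2,
  finite_set S & forall f, preserves_unit_distance S f -> Q f.

Lemma preserves_unit_distanceS (S T : set 'rV[R]_2) f :
  S `<=` T -> preserves_unit_distance T f -> preserves_unit_distance S f.
Proof. by move=> ST fT u v /ST Tu /ST Tv; apply: fT. Qed.

Lemma forced_mono P Q : forced P -> (forall f, P f -> Q f) -> forced Q.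
Proof. by move=> [S finS SP] PQ; exists S => // f /SP /PQ. Qed.

Lemma forcedT P : (forall f, P f) -> forced P.
Proof. by move=> Pf; exists set0. Qed.

Lemma forcedI P Q : forced P -> forced Q -> forced (fun f => P f /\ Q f).
Proof.
move=> [S finS SP] [T finT TQ]; exists (S `|` T).
  by rewrite finite_setU.
move=> f fST; split.
  by apply: SP; apply: preserves_unit_distanceS fST => x; left.
by apply: TQ; apply: preserves_unit_distanceS fST => x; right.
Qed.

Definition rigid t := forall x y, phi2 x y = t ->
  forced (fun f => phi2 (f x) (f y) = iota t).

Lemma rigid1 : rigid 1.
Proof.
move=> x y xy; exists [set x; y]; first exact: finite_set2.
move=> f fxy; rewrite rmorph1; apply: fxy; [by left|by right|].
exact/enormB_eq1.
Qed.

Lemma rigid0 : rigid 0.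
Proof.
by move=> x y /phi2_eq0 ->; apply: forcedT => f; rewrite phi2xx rmorph0.
Qed.

(** L has characteristic zero because it contains the field R. *)
Lemma natL_neq0 n : n.+1%:R != 0 :> L.
Proof. by rewrite -(rmorph_nat iota) fmorph_eq0 pnatr_eq0. Qed.

(** * Rigid rhombi *)

Lemma rhombus_dichotomy a b x y p q : rigid a -> rigid b -> 0 < a ->
  phi2 p q = a -> phi2 x p = b -> phi2 x q = b -> x + y = p + q ->
  forced (fun f => f x = f y \/ f x + f y = f p + f q).
Proof.
move=> Ra Rb a_gt0 pq xp xq e.
have [e0 e1] := (rV2P _ _).1 e; rewrite !mxE in e0 e1.
have yE i : i = 0 \/ i = 1 -> y 0 i = p 0 i + q 0 i - x 0 i.
  by case=> ->; rewrite -?e0 -?e1; ring.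
have yp : phi2 y p = b.
  by rewrite -xq /phi2 !yE; [ring|by right|by left].
have yq : phi2 y q = b.
  by rewrite -xp /phi2 !yE; [ring|by right|by left].
apply: (forced_mono (forcedI (Ra _ _ pq) (forcedI
  (forcedI (Rb _ _ xp) (Rb _ _ xq)) (forcedI (Rb _ _ yp) (Rb _ _ yq))))).
move=> f [fpq [[fxp fxq] [fyp fyq]]].
apply: equidistant_dichotomy fxp fxq fyp fyq; first exact: natL_neq0 1%N.
by rewrite fpq fmorph_eq0 gt_eqF.
Qed.

(** This is the spindle argument.  The point z completes the isosceles triangle
    with apex x, base yz of squared length e, and legs equal to the diagonal of
    the rhombus; a second rhombus has the leg xz as its diagonal.  If f x = f y,
    then f z has squared distance e from f x.  But either f z = f x, so that
    e = 0, or the second rhombus is mapped to a parallelogram, so that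
    e = 4 b - a. *)
Lemma rhombus_closes a b e x y p q : rigid a -> rigid b -> rigid e ->
  0 < a -> 0 < e < 4 * b - a ->
  phi2 p q = a -> phi2 x p = b -> phi2 x q = b -> x + y = p + q ->
  forced (fun f => f x + f y = f p + f q).
Proof.
move=> Ra Rb Re a_gt0 /andP[e_gt0 e_lt] pq xp xq sumE.
have c_gt0 := lt_trans e_gt0 e_lt.
have xy : phi2 x y = 4 * b - a.
  by have := phi2_parallelogram sumE; rewrite pq xp xq; lra.
have [||z [zx zy]] := @exists_triangle R (4 * b - a) e x y.
- by rewrite xy.
- rewrite xy; have : 0 <= e * (4 * (4 * b - a) - e) by rewrite mulr_ge0; lra.
  by lra.
have xz : phi2 x z = 4 * b - a by rewrite phi2C.
have [||p' [q' [pq' xp' xq' sumE']]] := @exists_rhombus R a b x z _ _ xz.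
- exact: ltW.
- by rewrite xz.
apply: (forced_mono (forcedI (Re _ _ zy) (forcedI
  (forcedI (Ra _ _ pq') (forcedI (Rb _ _ xp') (Rb _ _ xq')))
  (forcedI (rhombus_dichotomy Ra Rb a_gt0 pq xp xq sumE)
           (rhombus_dichotomy Ra Rb a_gt0 pq' xp' xq' sumE'))))).
move=> f [fzy [[fpq [fxp fxq]] [[fxy|//] [fxz|fxz]]]].
  move: fzy; rewrite -fxz fxy phi2xx => /esym/eqP.
  by rewrite fmorph_eq0 gt_eqF.
have eE : e = 4 * b - a.
  apply: (fmorph_inj iota); rewrite -fzy -fxy phi2C.
  have /(canRL (addrK _)) -> := phi2_parallelogram fxz.
  by rewrite fpq fxp fxq rmorphB rmorphM rmorph_nat; ring.
by rewrite -eE ltxx in e_lt.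
Qed.

Lemma rigid_diagonal a b e : rigid a -> rigid b -> rigid e ->
  0 < a -> 0 < e < 4 * b - a -> rigid (4 * b - a).
Proof.
move=> Ra Rb Re a_gt0 e_bnd x y xy.
have [||p [q [pq xp xq sumE]]] := @exists_rhombus R a b x y _ _ xy.
- exact: ltW.
- by rewrite xy; case/andP: e_bnd; apply: lt_trans.
apply: (forced_mono (forcedI
  (rhombus_closes Ra Rb Re a_gt0 e_bnd pq xp xq sumE)
  (forcedI (Ra _ _ pq) (forcedI (Rb _ _ xp) (Rb _ _ xq))))).
move=> f [fsum [fpq [fxp fxq]]].
have /(canRL (addrK _)) -> := phi2_parallelogram fsum.
by rewrite fpq fxp fxq rmorphB rmorphM rmorph_nat; ring.
Qed.

(** * Arithmetic progressions and rational scaling *)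

(** Let x y v be an equilateral triangle and m = v + y - x.  The rhombi x y m v
    and v y z m each consist of two equilateral triangles, so f maps them to
    parallelograms; adding the two relations eliminates f v and f m. *)
Lemma forced_midpoint t x y z : rigid t -> 0 < t ->
  phi2 x y = t -> x + z = y + y ->
  forced (fun f => f x + f z = f y + f y).
Proof.
move=> Rt t_gt0 xy xz.
have [||v [vx vy]] := @exists_triangle R t t x y; rewrite ?xy //; first by nra.
pose m := v + y - x.
have xm : x + m = y + v by rewrite /m [LHS]addrC subrK addrC.
have vz : v + z = y + m.
  have -> : z = y + y - x by rewrite -xz [x + z]addrC addrK.
  by rewrite /m !addrA [v + y]addrC.
have [e0 e1] := (rV2P _ _).1 xz; rewrite !mxE in e0 e1.
have ym : phi2 y m = t by rewrite -vx /phi2 !mxE; ring.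
have vm : phi2 v m = t by rewrite -xy /phi2 !mxE; ring.
have e_bnd : 0 < t < 4 * t - t by apply/andP; split; lra.
have yv : phi2 y v = t by rewrite phi2C.
have xv : phi2 x v = t by rewrite phi2C.
apply: (forced_mono (forcedI
  (rhombus_closes Rt Rt Rt t_gt0 e_bnd yv xy xv xm)
  (rhombus_closes Rt Rt Rt t_gt0 e_bnd ym vy vm vz))).
move=> f [fxm fvz]; apply: (addIr (f v + f m)).
by rewrite [RHS]addrACA -fxm -fvz [LHS]addrACA [RHS]addrACA [f z + _]addrC.
Qed.

Lemma forced_progression t x u n : rigid t -> 0 < t ->
  phi2 x (x + u) = t ->
  forced (fun f => f (x + u *+ n) = f x + (f (x + u) - f x) *+ n).
Proof.
move=> Rt t_gt0 xu.
have step k : forced (fun f =>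
    f (x + u *+ k.+1) - f (x + u *+ k) = f (x + u) - f x).
  elim: k => [|k IHk]; first by apply: forcedT => f; rewrite mulr0n addr0.
  have d : phi2 (x + u *+ k) (x + u *+ k.+1) = t.
    by rewrite -xu mulrS /phi2 !mxE; ring.
  have mid : x + u *+ k + (x + u *+ k.+2) = x + u *+ k.+1 + (x + u *+ k.+1).
    by rewrite addrACA [RHS]addrACA -!mulrnDr addnS addSn.
  apply: (forced_mono (forcedI IHk (forced_midpoint Rt t_gt0 d mid))).
  move=> f [<- midf]; apply/eqP.
  by rewrite subr_eq addrAC -midf [f _ + _]addrC addrK.
elim: n => [|n IHn]; first by apply: forcedT => f; rewrite !mulr0n !addr0.
apply: (forced_mono (forcedI (step n) IHn)) => f [stepE IH].
by rewrite [in RHS]mulrSr addrA -IH -stepE addrC subrK.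
Qed.

(** Points at squared distance n^2 t are the ends of a progression with n steps
    of squared length t. *)
Lemma rigid_mulX2 t n : rigid t -> 0 < t -> (0 < n)%N ->
  rigid (n%:R ^+ 2 * t).
Proof.
move=> Rt t_gt0 n_gt0 x y xy.
have n_neq0 : n%:R != 0 :> R by rewrite pnatr_eq0 -lt0n.
pose u := n%:R^-1 *: (y - x).
have yE : y = x + u *+ n.
  by rewrite -scaler_nat scalerA divff // scale1r addrC subrK.
have xu : phi2 x (x + u) = t.
  apply: (mulfI (expf_neq0 2 n_neq0)).
  by have := phi2_homothety x 0 u n; rewrite mul0rn addr0 -yE xy.
apply: (forced_mono (forcedI (Rt _ _ xu) (forced_progression n Rt t_gt0 xu))).
move=> f [fxu]; rewrite -yE => ->.
have := phi2_homothety (f x) 0 (f (x + u) - f x) n.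
rewrite mul0rn addr0 [f x + (_ - _)]addrC subrK fxu => ->.
by rewrite rmorphM rmorphXn rmorph_nat.
Qed.

(** Given p and q at squared distance s / n^2, the bound on s gives an apex x at
    squared distance t from both.  The homothety of centre x and ratio n moves
    p and q to points at the rigid squared distance s, and f commutes with this
    homothety since it preserves progressions along the two legs. *)
Lemma rigid_divX2 s t n : rigid s -> rigid t -> 0 < s -> 0 < t ->
  (0 < n)%N -> s <= 4 * (n%:R ^+ 2 * t) -> rigid (s / n%:R ^+ 2).
Proof.
move=> Rs Rt s_gt0 t_gt0 n_gt0 s_le p q pq.
have n2_gt0 : 0 < n%:R ^+ 2 :> R by rewrite exprn_gt0 // ltr0n.
set r := s / _ in pq *.
have rE : s = n%:R ^+ 2 * r by rewrite mulrC divfK ?gt_eqF.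
have r_gt0 : 0 < r by rewrite divr_gt0.
have r_le : r <= 4 * t by rewrite ler_pdivrMr // mulrAC -mulrA.
have [||x [xp xq]] := @exists_triangle R t t p q; rewrite ?pq //.
  have : 0 <= r * (4 * t - r) by rewrite mulr_ge0 ?subr_ge0 // ltW.
  by lra.
pose u := p - x; pose v := q - x.
have pE : x + u = p by rewrite addrC subrK.
have qE : x + v = q by rewrite addrC subrK.
have xu : phi2 x (x + u) = t by rewrite pE.
have xv : phi2 x (x + v) = t by rewrite qE.
have uv : phi2 (x + u *+ n) (x + v *+ n) = s.
  by rewrite phi2_homothety pE qE pq.
apply: (forced_mono (forcedI (Rs _ _ uv) (forcedI
  (forced_progression n Rt t_gt0 xu) (forced_progression n Rt t_gt0 xv)))).
move=> f [+ [fu fv]]; rewrite fu fv phi2_homothety pE qE ![f x + _]addrC !subrK.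
rewrite rE rmorphM rmorphXn rmorph_nat; apply: mulfI.
by rewrite expf_neq0 //; case: (n) n_gt0 => // k _; apply: natL_neq0.
Qed.

(** The division by n^2 comes first because 1 satisfies the bound of
    [rigid_divX2] for every n, while m^2 may be too large for it. *)
Lemma rigid_sqr_quotient m n : (0 < m)%N -> (0 < n)%N ->
  rigid ((m%:R / n%:R) ^+ 2).
Proof.
move=> m_gt0 n_gt0.
have n2_gt0 : 0 < n%:R ^+ 2 :> R by rewrite exprn_gt0 // ltr0n.
have Rn : rigid (1 / n%:R ^+ 2).
  apply: (rigid_divX2 rigid1 rigid1) => //.
  rewrite mulr1; have : 1 <= n%:R ^+ 2 :> R; last by lra.
  by rewrite -natrX ler1n expn_gt0 n_gt0.
rewrite expr_div_n -[_^-1]div1r.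
by apply: rigid_mulX2 => //; apply: divr_gt0.
Qed.

Lemma rigid_arbitrarily_small t : 0 < t -> exists2 e, rigid e & 0 < e < t.
Proof.
move=> t_gt0; pose n := Num.bound t^-1.
have n_gt : t^-1 < n%:R by apply: archi_boundP; rewrite invr_ge0 ltW.
have n_gt0 : (0 < n)%N by rewrite -(ltr0n R) (lt_trans _ n_gt) ?invr_gt0.
exists ((1 / n%:R) ^+ 2); first exact: (@rigid_sqr_quotient 1).
rewrite exprn_gt0 ?divr_gt0 ?ltr0n //= div1r exprVn.
rewrite invf_plt ?posrE //; last by rewrite exprn_gt0 ?ltr0n.
by rewrite (lt_le_trans n_gt) // -natrX ler_nat -[leqLHS]expn1 leq_pexp2l.
Qed.

(** For t = k / n the identity t = 4 ((t + 1) / 4)^2 - ((t - 1) / 2)^2 puts t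
    in the form 4 b - a with a and b rational squares.  The case
    t = 1 is separate since a vanishes there and the rhombus degenerates. *)
Lemma rigid_rational t : 0 <= t -> rational t -> rigid t.
Proof.
rewrite le_eqVlt => /predU1P[<- _|t_gt0]; first exact: rigid0.
have [-> _|t_neq1] := eqVneq t 1; first exact: rigid1.
case/rationalP => k [n tE].
have n_gt0 : (0 < n)%N.
  rewrite lt0n; apply: contraTneq t_gt0 => n0.
  by rewrite tE n0 invr0 mulr0 ltxx.
have n_gt0' : 0 < n%:R :> R by rewrite ltr0n.
case: k tE => [k|k] tE; last first.
  by move: t_gt0; rewrite tE NegzE pmulr_lgt0 ?invr_gt0 // ltr0z.
have {}tE : t = k%:R / n%:R by [].
have k_neqn : k != n.
  by apply: contraNneq t_neq1 => kn; rewrite tE kn divff // gt_eqF.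
(* The distance of k and n: one of the two truncated differences is zero. *)
pose m := (k - n + (n - k))%N.
have mE : m%:R ^+ 2 = (k%:R - n%:R) ^+ 2 :> R.
  rewrite /m; have [kn|nk|->] := ltngtP k n; last by rewrite subnn addn0 subrr.
    by rewrite (eqP (ltnW kn)) add0n natrB 1?ltnW // -sqrrN opprB.
  by rewrite (eqP (ltnW nk)) addn0 natrB // ltnW.
have m_gt0 : (0 < m)%N by rewrite /m addn_gt0 !subn_gt0 orbC -neq_ltn.
have [e Re e_bnd] := rigid_arbitrarily_small t_gt0.
pose a : R := (m%:R / (2 * n)%:R) ^+ 2.
pose b : R := ((k + n)%:R / (4 * n)%:R) ^+ 2.
have abE : t = 4 * b - a.
  rewrite /a /b !expr_div_n mE tE !natrM natrD; field.
  by rewrite gt_eqF.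
rewrite abE; apply: (@rigid_diagonal a b e) => //; last by rewrite -abE.
- by apply: rigid_sqr_quotient; rewrite ?muln_gt0.
- by apply: rigid_sqr_quotient; rewrite ?muln_gt0 ?addn_gt0 ?n_gt0 ?orbT.
- by rewrite exprn_gt0 // divr_gt0 // ltr0n ?muln_gt0.
Qed.

End Forcing.

Theorem theorem2 (R : realType) (L : fieldType) (iota : {rmorphism R -> L})
    (FF : divringClosed L) :
  (forall x y : 'rV[R]_2,
      rational (enorm (x - y) ^+ 2) ->
      exists S : set 'rV[R]_2,
        [/\ finite_set S,
            [set x; y] `<=` S &
            forall f : 'rV[R]_2 -> 'rV[L]_2,
              set_fun S (plane_over FF) f ->
              preserves_unit_distance S f -> preserves_distance iota f x y])
  /\ [set d : R | 0 < d /\ rational (d ^+ 2)] `<=` D2 iota FF.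
Proof.
have main x y : rational (enorm (x - y) ^+ 2) -> has_forcing_set iota FF x y.
  move=> rat_xy; have d_ge0 := sqr_ge0 (enorm (x - y)).
  have [S finS forceS] :=
    rigid_rational iota d_ge0 rat_xy (esym (sqr_enormB x y)).
  exists (S `|` [set x; y]); split.
  - by rewrite finite_setU; split => //; apply: finite_set2.
  - by move=> z; right.
  - move=> f _ fS; apply: forceS.
    by apply: preserves_unit_distanceS fS => z; left.
split=> [x y /main //|d [d_gt0 rat_d]]; split=> // x y xy.
by apply: main; rewrite xy.
Qed.
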